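(* Let $ABC_1C_2D$ be a 4-right pentagon in the hyperbolic plane, with right angles at $B, C_1, C_2, D$ (and perhaps a non-right angle at $A$). Let $A_*$ be the orthogonal projection of $A$ onto the line $BD$, and let $C_*$ be the intersection of $BD$ with the common perpendicular of the lines $BD$ and $C_1C_2$. Then the midpoint of $\overline{BD}$ is also the midpoint of $\overline{A_*C_*}$.
   Context: A 4-right pentagon is a hyperbolic pentagon (a simple polygon whose vertices are listed in cyclic order) having at least four right angles, here at all the vertices different from $A$. The midpoint of a degenerate segment (equal endpoints) is that endpoint. *)

(* Defs.v *)
From HB Require Import structures.
From mathcomp Require Import all_boot all_order all_algebra.
From mathcomp Require Import all_classical all_reals all_analysis.

Set Implicit Arguments.
Unset Strict Implicit.
Unset Printing Implicit Defensive.

Import Order.TTheory GRing.Theory Num.Theory.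
Local Open Scope classical_set_scope.
Local Open Scope ring_scope.

(* The hyperbolic plane is the hyperboloid model: the upper sheet of
   <x, x> = -1 in Minkowski space R^{1,2}; coordinate 0 is the timelike one. *)

Definition mink (R : realType) (u v : 'rV[R]_3) : R :=
  - (u 0 0 * v 0 0) + u 0 1 * v 0 1 + u 0 2 * v 0 2.

Record hpoint (R : realType) := HPoint {
  hvec :> 'rV[R]_3;
  hvecP : (mink hvec hvec == -1) && (0 < hvec 0 0) }.

HB.instance Definition _ (R : realType) := [isSub for @hvec R].

(* arcosh of - <P, Q>, using arcosh x = ln (x + sqrt (x^2 - 1)). *)
Definition hdist (R : realType) (P Q : hpoint R) : R :=
  let c := - mink P Q in ln (c + Num.sqrt (c ^+ 2 - 1)).

(* The radial projection of the Euclidean chord [P, Q] to the hyperboloid,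
   i.e. the geodesic segment (both endpoints included). *)
Definition hsegment (R : realType) (P Q : hpoint R) : set (hpoint R) :=
  [set X | exists a b : R,
     [/\ 0 <= a, 0 <= b & hvec X = a *: hvec P + b *: hvec Q]].

(* The intersection of the hyperboloid with the linear span of P and Q:
   the geodesic line through P and Q when these are distinct. *)
Definition hline (R : realType) (P Q : hpoint R) : set (hpoint R) :=
  [set X | exists a b : R, hvec X = a *: hvec P + b *: hvec Q].

Definition is_hline (R : realType) (l : set (hpoint R)) : Prop :=
  exists P Q : hpoint R, P <> Q /\ l = hline P Q.

(* The orthogonal projection of P to the tangent plane Q^\perp at Q. It is a
   positive multiple of the initial velocity at Q of the geodesic from Q to P,
   and vanishes exactly when P = Q. *)
Definition tanv (R : realType) (Q P : hpoint R) : 'rV[R]_3 :=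
  hvec P + mink P Q *: hvec Q.

Definition right_angle (R : realType) (P Q S : hpoint R) : Prop :=
  [/\ P <> Q, S <> Q & mink (tanv Q P) (tanv Q S) = 0].

Definition perp_lines (R : realType) (l m : set (hpoint R)) : Prop :=
  exists F : hpoint R,
    [/\ l F, m F &
        forall X Y, l X -> m Y -> mink (tanv F X) (tanv F Y) = 0].

Definition common_perp (R : realType) (n l m : set (hpoint R)) : Prop :=
  [/\ is_hline n, perp_lines n l & perp_lines n m].

(* F is the foot of the perpendicular from P to the line l (F = P if P is
   on l, since tanv F P is then orthogonal to itself). *)
Definition is_orth_proj (R : realType) (P : hpoint R) (l : set (hpoint R))
    (F : hpoint R) : Prop :=
  l F /\ forall X, l X -> mink (tanv F P) (tanv F X) = 0.

Definition is_midpoint (R : realType) (P Q M : hpoint R) : Prop :=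
  hsegment P Q M /\ hdist P M = hdist M Q.

(* ordS is the cyclic successor on 'I_n; side i joins v i to v (ordS i). *)
Definition side (R : realType) (n : nat) (v : 'I_n -> hpoint R) (i : 'I_n) :
    set (hpoint R) :=
  hsegment (v i) (v (ordS i)).

Definition simple_polygon (R : realType) (n : nat) (v : 'I_n -> hpoint R) :
    Prop :=
  [/\ injective v,
      forall i, side v i `&` side v (ordS i) = [set v (ordS i)] &
      forall i j, j != i -> j != ordS i -> i != ordS j ->
        side v i `&` side v j = set0].

(* right_angle does not distinguish interior angles pi/2 and 3pi/2, but no
   reflex angle occurs here: the interior angles of a hyperbolic pentagon sum
   to less than 3pi, so four of them in {pi/2, 3pi/2} are all pi/2. *)
Definition four_right_pentagon (R : realType) (A B C1 C2 D : hpoint R) :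
    Prop :=
  simple_polygon (tnth [tuple A; B; C1; C2; D]) /\
  [/\ right_angle A B C1, right_angle B C1 C2,
      right_angle C1 C2 D & right_angle C2 D A].

(* Main.v *)
Require Import Defs.
From mathcomp Require Import all_boot all_order all_algebra.
From mathcomp Require Import all_classical all_reals all_analysis.
From mathcomp Require Import ring lra.
Import Order.TTheory GRing.Theory Num.Theory.
Local Open Scope ring_scope.
Local Open Scope classical_set_scope.

(** On the plane spanned by [B] and [D], the isometry exchanging [B] and [D]
    is the symmetry about the midpoint, so it suffices to show
    [<A*, B> <C*, B> = <A*, D> <C*, D>]. Let [w] be normal to [C1 C2]. The
    right angles give [<A, B> <w, B> = - <A, w> = <A, D> <w, D>]. Projecting
    [A] to [BD] does not change the ratio of its products with [B] and [D], so
    [A*] satisfies [<A*, B> <w, B> = <A*, D> <w, D>]; the common perpendicular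
    contains the direction [w], so [w] restricted to the plane of [BD] is a
    multiple of [<C*, ->], whence [<C*, D> <w, B> = <C*, B> <w, D>]. *)

Section Mink.
Set Implicit Arguments.
Unset Strict Implicit.
Variable R : realType.
Implicit Types (u v w : 'rV[R]_3) (P Q X : hpoint R).

(** * The Minkowski form and the points of the hyperboloid *)

Lemma minkC u v : mink u v = mink v u.
Proof. by rewrite /mink; ring. Qed.

Lemma minkDl u v w : mink (u + v) w = mink u w + mink v w.
Proof. by rewrite /mink !mxE; ring. Qed.

Lemma minkDr u v w : mink w (u + v) = mink w u + mink w v.
Proof. by rewrite /mink !mxE; ring. Qed.

Lemma minkZl a u w : mink (a *: u) w = a * mink u w.
Proof. by rewrite /mink !mxE; ring. Qed.

Lemma minkZr a u w : mink w (a *: u) = a * mink w u.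
Proof. by rewrite /mink !mxE; ring. Qed.

Definition minkE := (minkDl, minkDr, minkZl, minkZr).

Lemma row3P u v : u 0 0 = v 0 0 -> u 0 1 = v 0 1 -> u 0 2 = v 0 2 -> u = v.
Proof.
move=> e0 e1 e2; apply/rowP => -[[|[|[|//]]] lt_i].
- by rewrite (_ : Ordinal lt_i = 0) //; apply/val_inj.
- by rewrite (_ : Ordinal lt_i = 1) //; apply/val_inj.
- by rewrite (_ : Ordinal lt_i = 2) //; apply/val_inj.
Qed.

Lemma mink_hpoint P : mink P P = -1.
Proof. by case/andP: (hvecP P) => /eqP. Qed.

Lemma hpoint_gt0 P : 0 < hvec P 0 0.
Proof. by case/andP: (hvecP P). Qed.

(** Reverse Cauchy-Schwarz: a Lagrange identity writes [(x * y) ^+ 2 - (1 + a * c + b * d) ^+ 2] as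
    a sum of three squares, all zero in the equality case. *)
Lemma mink_le_eq P Q : mink P Q <= -1 /\ (mink P Q = -1 -> P = Q).
Proof.
have := mink_hpoint P; have := mink_hpoint Q.
have := hpoint_gt0 P; have := hpoint_gt0 Q.
rewrite /mink => q0 p0 qq pp.
set x := hvec P 0 0 in p0 pp *; set y := hvec Q 0 0 in q0 qq *.
set a := hvec P 0 1 in pp *; set b := hvec P 0 2 in pp *.
set c := hvec Q 0 1 in qq *; set d := hvec Q 0 2 in qq *.
have xy0 : 0 < x * y by rewrite mulr_gt0.
have E : (x * y) ^+ 2 - (1 + a * c + b * d) ^+ 2
    = (a - c) ^+ 2 + (b - d) ^+ 2 + (a * d - b * c) ^+ 2.
  have -> : (x * y) ^+ 2 = (x * x) * (y * y) by ring.
  have -> : x * x = 1 + a * a + b * b by lra.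
  have -> : y * y = 1 + c * c + d * d by lra.
  by ring.
have le : 1 + a * c + b * d <= x * y.
  have [neg|pos] := ltP (1 + a * c + b * d) 0; first by lra.
  rewrite -(ler_pXn2r (n := 2)) ?nnegrE // ?(ltW xy0) // -subr_ge0 E.
  by rewrite !addr_ge0 ?sqr_ge0.
split; first by lra.
move=> eq1.
have {}E : (a - c) ^+ 2 + (b - d) ^+ 2 + (a * d - b * c) ^+ 2 = 0.
  by rewrite -E (_ : x * y = 1 + a * c + b * d) ?subrr //; lra.
have s1 := sqr_ge0 (a - c); have s2 := sqr_ge0 (b - d).
have s3 := sqr_ge0 (a * d - b * c).
have /eqP : (a - c) ^+ 2 = 0 by lra.
rewrite sqrf_eq0 subr_eq0 => /eqP ac.
have /eqP : (b - d) ^+ 2 = 0 by lra.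
rewrite sqrf_eq0 subr_eq0 => /eqP bd.
apply/val_inj/row3P; rewrite //=.
rewrite -/x -/y; apply/eqP; rewrite -(eqrXn2 (n := 2)) ?ltW //.
by apply/eqP; rewrite !expr2; rewrite ac bd in pp; lra.
Qed.

Lemma mink_le P Q : mink P Q <= -1.
Proof. by have [] := mink_le_eq P Q. Qed.

Lemma mink_lt P Q : P <> Q -> mink P Q < -1.
Proof.
move=> PQ; have [le eq] := mink_le_eq P Q.
by rewrite lt_neqAle le andbT; apply: contra_notN PQ => /eqP /eq.
Qed.

Lemma mink_lt0 P Q : mink P Q < 0.
Proof. by apply: le_lt_trans (mink_le P Q) _; rewrite oppr_lt0. Qed.

Lemma arcosh_inj (c d : R) : 1 <= c -> 1 <= d ->
  ln (c + Num.sqrt (c ^+ 2 - 1)) = ln (d + Num.sqrt (d ^+ 2 - 1)) -> c = d.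
Proof.
move=> c1 d1.
have pos (x : R) : 1 <= x -> x + Num.sqrt (x ^+ 2 - 1) \is Num.pos.
  by move=> x1; rewrite posrE; have := sqrtr_ge0 (x ^+ 2 - 1); lra.
move/(ln_inj (pos c c1) (pos d d1)).
wlog cd : c d c1 d1 / c < d.
  move=> wl e; have [cd|dc|//] := ltgtP c d; first exact: wl.
  by apply/esym/wl.
have : Num.sqrt (c ^+ 2 - 1) <= Num.sqrt (d ^+ 2 - 1).
  by apply: ler_wsqrtr; nra.
by lra.
Qed.

Lemma hdist_inj P Q X Y : hdist P Q = hdist X Y -> mink P Q = mink X Y.
Proof.
have ge1 P' Q' : 1 <= - mink (hvec P') (hvec Q').
  by rewrite lerNr; exact: mink_le.
by move/arcosh_inj => /(_ (ge1 _ _) (ge1 _ _)) /oppr_inj.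
Qed.

Lemma mink_tanv Q P X :
  mink (tanv Q P) (tanv Q X) = mink P X + mink P Q * mink Q X.
Proof.
by rewrite /tanv !minkE mink_hpoint (minkC X Q); ring.
Qed.

Lemma hlinel P Q : hline P Q P.
Proof. by exists 1, 0; rewrite scale1r scale0r addr0. Qed.

Lemma hliner P Q : hline P Q Q.
Proof. by exists 0, 1; rewrite scale1r scale0r add0r. Qed.

(** * Normal vectors and right angles *)

(** The Euclidean cross product with its last two coordinates negated, which makes it orthogonal to
    [u] and [v] for [mink]. *)
Definition mink_cross u v : 'rV[R]_3 :=
  \row_(i < 3) [:: u 0 1 * v 0 2 - u 0 2 * v 0 1;
                   u 0 0 * v 0 2 - u 0 2 * v 0 0;
                   u 0 1 * v 0 0 - u 0 0 * v 0 1]`_i.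

Lemma mink_cross_cross u v :
  mink (mink_cross u v) (mink_cross u v) = mink u v ^+ 2 - mink u u * mink v v.
Proof. by rewrite /mink !mxE /=; ring. Qed.

(** Each 2x2 minor of [w] and the cross product is a combination of [mink w u] and [mink w v], hence
    zero. *)
Lemma orth_mink_cross u v w : mink w u = 0 -> mink w v = 0 ->
  mink (mink_cross u v) (mink_cross u v) *: w
    = mink w (mink_cross u v) *: mink_cross u v.
Proof.
move=> wu wv.
have e0 : w 0 1 * mink_cross u v 0 0 = w 0 0 * mink_cross u v 0 1.
  apply/eqP; rewrite -subr_eq0; apply/eqP; rewrite !mxE /=.
  transitivity (mink w u * v 0 2 - mink w v * u 0 2); last first.
    by rewrite wu wv !mul0r subrr.
  by rewrite /mink; ring.
have e1 : w 0 2 * mink_cross u v 0 0 = w 0 0 * mink_cross u v 0 2.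
  apply/eqP; rewrite -subr_eq0; apply/eqP; rewrite !mxE /=.
  transitivity (mink w v * u 0 1 - mink w u * v 0 1); last first.
    by rewrite wu wv !mul0r subrr.
  by rewrite /mink; ring.
have e2 : w 0 2 * mink_cross u v 0 1 = w 0 1 * mink_cross u v 0 2.
  apply/eqP; rewrite -subr_eq0; apply/eqP; rewrite !mxE /=.
  transitivity (mink w v * u 0 0 - mink w u * v 0 0); last first.
    by rewrite wu wv !mul0r subrr.
  by rewrite /mink; ring.
move: (mink_cross u v) e0 e1 e2 => n e0 e1 e2.
(* Multiplying the vanishing minors by coordinates of [n] makes the remaining goals linear in the
   monomials. *)
have m (a b c : R) : a = b -> c * a = c * b by move=> ->.
apply: row3P; rewrite !mxE /mink.
- by have := m _ _ (n 0 1) e0; have := m _ _ (n 0 2) e1; lra.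
- by have := m _ _ (n 0 0) e0; have := m _ _ (n 0 2) e2; lra.
- by have := m _ _ (n 0 0) e1; have := m _ _ (n 0 1) e2; lra.
Qed.

(* The vectors orthogonal to two independent vectors form a line, so [u] and
   [w] are parallel. *)
Lemma mink_orth2 P Q u w v : P <> Q ->
  mink u P = 0 -> mink u Q = 0 -> mink w P = 0 -> mink w Q = 0 ->
  mink w w * mink u v = mink u w * mink w v.
Proof.
move=> /mink_lt PQ uP uQ wP wQ.
(* The square of the cross product is [mink P Q ^+ 2 - 1], positive for distinct points. *)
have n0 : mink (mink_cross P Q) (mink_cross P Q) != 0.
  by rewrite mink_cross_cross !mink_hpoint lt0r_neq0 //; nra.
have par x : mink x P = 0 -> mink x Q = 0 -> exists a, x = a *: mink_cross P Q.
  move=> xP xQ; exists (mink x (mink_cross P Q)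
    / mink (mink_cross P Q) (mink_cross P Q)).
  by rewrite mulrC -scalerA -orth_mink_cross // scalerA mulVf ?scale1r.
have [a ->] := par u uP uQ; have [b ->] := par w wP wQ.
by rewrite !minkE; ring.
Qed.

(* The component of [B] orthogonal to [C] is parallel to the normal [w] of the
   line [C C']. *)
Lemma right_angles_mink (A B C C' : hpoint R) w :
  right_angle A B C -> right_angle B C C' ->
  mink w C = 0 -> mink w C' = 0 -> 0 < mink w w ->
  mink w B != 0 /\ mink A B * mink w B = - mink A w.
Proof.
rewrite /right_angle !mink_tanv => -[_ _ hB] [BC C'C hC] wC wC' w0.
have BC1 := mink_lt BC.
have nCC' : C <> C' by move/esym.
pose u := hvec B + mink B C *: hvec C.
have uC : mink u C = 0 by rewrite /u !minkE mink_hpoint; ring.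
have uC' : mink u C' = 0 by rewrite /u !minkE -hC; ring.
have uw : mink u w = mink w B.
  by rewrite /u !minkE (minkC C) wC (minkC B w); ring.
(* Pairing the parallel vectors [u] and [w] with [B] and with [A] gives two equations sharing the
   factor [mink w w * (mink B C ^+ 2 - 1)], which is then eliminated. *)
have eB := mink_orth2 B nCC' uC uC' wC wC'.
have eA := mink_orth2 A nCC' uC uC' wC wC'.
have uB : mink u B = mink B C ^+ 2 - 1.
  by rewrite /u !minkE mink_hpoint (minkC C B); ring.
have uA : mink u A = - mink A B * (mink B C ^+ 2 - 1).
  have -> : mink u A = mink A B + mink B C * mink A C.
    by rewrite /u !minkE (minkC B A) (minkC C A).
  have -> : mink A C = - (mink A B * mink B C) by apply/eqP; rewrite -addr_eq0 hB.
  by ring.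
rewrite uw uB in eB; rewrite uw uA (minkC w A) in eA.
have wB0 : mink w B != 0.
  apply/eqP => wB; move: eB; rewrite wB mul0r => /eqP.
  by rewrite mulf_eq0 !gt_eqF //; nra.
split=> //; apply: (mulfI wB0).
rewrite mulrN -eA mulrCA -eB; ring.
Qed.

(** * Coordinates on a line and midpoints *)

Lemma coord_swap_eq (c x y s t : R) : 1 < c ->
  x ^+ 2 + y ^+ 2 + 2 * c * x * y = 1 -> s ^+ 2 + t ^+ 2 + 2 * c * s * t = 1 ->
  0 < x + y -> 0 < s + t ->
  (x + c * y) * (s + c * t) = (c * x + y) * (c * s + t) ->
  s = y /\ t = x.
Proof.
move=> c1 exy est xy st e.
(* The two sides of [e] differ by [(1 - c ^+ 2) * (x * s - y * t)]. *)
have xs : x * s = y * t.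
  have c2 : 1 - c ^+ 2 != 0 by rewrite lt_eqF //; nra.
  by apply: (mulfI c2); apply/eqP; rewrite -subr_eq0; apply/eqP; lra.
(* Hence [(s, t)] is [k] times [(y, x)], with [k] the ratio of the coordinate sums; both have norm 1
   for the same symmetric form, so [k = 1]. *)
have [k k0 [sk tk]] : exists2 k, 0 < k & s = k * y /\ t = k * x.
  exists ((s + t) / (x + y)); first by rewrite divr_gt0.
  split; apply: (mulIf (lt0r_neq0 xy)); rewrite mulrAC divfK ?lt0r_neq0 //; lra.
have k1 : k ^+ 2 = 1.
  rewrite -[LHS]mulr1 -[in LHS]exy -[RHS]est sk tk; ring.
have {}k1 : k = 1.
  by apply/eqP; rewrite -(eqrXn2 (n := 2)) ?expr1n ?k1 // ltW.
by rewrite sk tk k1 !mul1r.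
Qed.

(** The negative numbers [mink X P] and [mink X Q] add up to [(a + b) * (mink P Q - 1)]. *)
Lemma hline_coord_gt0 P Q X a b :
  hvec X = a *: hvec P + b *: hvec Q -> 0 < a + b.
Proof.
move=> eX; have := mink_lt0 X P; have := mink_lt0 X Q; have := mink_lt0 P Q.
rewrite eX !minkE !mink_hpoint (minkC Q P) => PQ lP lQ.
have : (a + b) * (mink P Q - 1) < 0 by lra.
by rewrite nmulr_llt0 //; lra.
Qed.

(* The reflection exchanging [P] and [Q] maps [X] to [Y]. *)
Lemma hline_swap P Q X Y : P <> Q -> hline P Q X -> hline P Q Y ->
  mink X P * mink Y P = mink X Q * mink Y Q ->
  exists x y : R, [/\ 0 < x + y, hvec X = x *: hvec P + y *: hvec Q
                    & hvec Y = y *: hvec P + x *: hvec Q].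
Proof.
move=> /mink_lt PQ [x [y eX]] [s [t eY]] e.
have xy := hline_coord_gt0 eX; have st := hline_coord_gt0 eY.
(* Here [- mink P Q] is the hyperbolic cosine of the distance from [P] to [Q]. *)
have [] := @coord_swap_eq (- mink P Q) x y s t _ _ _ xy st _.
- by lra.
- have := mink_hpoint X; rewrite eX !minkE !mink_hpoint (minkC Q P); lra.
- have := mink_hpoint Y; rewrite eY !minkE !mink_hpoint (minkC Q P); lra.
- by move: e; rewrite eX eY !minkE !mink_hpoint (minkC Q P); lra.
- by move=> sy tx; exists x, y; split=> //; rewrite eY sy tx.
Qed.

Lemma midpoint_coord P Q M : P <> Q -> is_midpoint P Q M ->
  exists2 m : R, 0 < m & hvec M = m *: (hvec P + hvec Q).
Proof.
move=> /mink_lt PQ [[a [b [a0 b0 eM]]] /hdist_inj].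
have ab := hline_coord_gt0 eM.
rewrite eM !minkE !mink_hpoint => e.
have e' : a = b.
  have /eqP : (a - b) * (1 + mink P Q) = 0 by lra.
  rewrite mulf_eq0 [X in _ || X]lt_eqF ?orbF ?subr_eq0; last by lra.
  by move/eqP.
by exists a; [lra | rewrite e' scalerDr].
Qed.

(** The sum of [X] and [Y] is [x + y] times the sum of [P] and [Q], so [M] is a positive multiple of
    both sums. *)
Lemma midpoint_swap P Q X Y M (x y : R) : P <> Q -> 0 < x + y ->
  hvec X = x *: hvec P + y *: hvec Q -> hvec Y = y *: hvec P + x *: hvec Q ->
  is_midpoint P Q M -> is_midpoint X Y M.
Proof.
move=> PQ xy eX eY /(midpoint_coord PQ) [m m0 eM].
have k0 : 0 <= m / (x + y) by rewrite divr_ge0 ?ltW.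
split.
  exists (m / (x + y)), (m / (x + y)); split=> //.
  rewrite -scalerDr eX eY addrACA -!scalerDl (addrC y) -scalerDr scalerA.
  by rewrite divfK ?lt0r_neq0.
suff e : mink X M = mink M Y by rewrite /hdist e.
by rewrite eM eX eY !minkE !mink_hpoint (minkC Q P); ring.
Qed.

(** * Projections and the common perpendicular *)

Lemma orth_proj_mink A F P Q X : is_orth_proj A (hline P Q) F ->
  hline P Q X -> mink A X = - mink A F * mink F X.
Proof.
by move=> [_ h] /h; rewrite mink_tanv => /eqP; rewrite addr_eq0 mulNr => /eqP.
Qed.

(* The normal [w] is the direction at [C1 C2] of the common perpendicular. *)
Lemma common_perp_normal p B D C1 C2 : common_perp p (hline B D) (hline C1 C2) ->
  exists2 F, (hline B D `&` p) F & exists w : 'rV[R]_3,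
    [/\ 0 < mink w w, mink w C1 = 0, mink w C2 = 0 &
        forall X, hline B D X -> mink w X = - mink w F * mink F X].
Proof.
move=> [[P [Q [PQ ->]]] [F [pF lF hF]] [G [pG mG hG]]].
exists F => //.
(* A direction at [G] needs another point of the perpendicular; one of the distinct points [P] and
   [Q] serves. *)
have [Z pZ ZG] : exists2 Z, hline P Q Z & Z <> G.
  have [PG|PG] := pselect (P = G); last by exists P => //; exact: hlinel.
  by exists Q; [exact: hliner | rewrite -PG => /esym].
(* This is [tanv G Z], orthogonal to [C1] and [C2] by the right angle at [G]. *)
exists (hvec Z + mink Z G *: hvec G).
have tanE Y : hline C1 C2 Y -> mink (hvec Z + mink Z G *: hvec G) Y = 0.
  by move=> mY; rewrite !minkE -(hG Z Y pZ mY) mink_tanv.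
split.
- rewrite !minkE !mink_hpoint (minkC G Z).
  have := mink_lt ZG; nra.
- exact/tanE/hlinel.
- exact/tanE/hliner.
(* The right angle at [F] makes both [Z] and [G] pair with [X] as multiples of [mink F X]. *)
- move=> X lX; rewrite !minkE.
  have := hF Z X pZ lX; have := hF G X pG lX; rewrite !mink_tanv.
  move=> /eqP; rewrite addr_eq0 => /eqP ->.
  by move=> /eqP; rewrite addr_eq0 => /eqP ->; ring.
Qed.

Lemma right_angleC P Q X : right_angle P Q X -> right_angle X Q P.
Proof. by case=> *; split; rewrite // minkC. Qed.

End Mink.

Theorem theorem6 (R : realType) (A B C1 C2 D Astar Cstar M : hpoint R)
    (p : set (hpoint R))
    (hpent : four_right_pentagon A B C1 C2 D)
    (hA : is_orth_proj A (hline B D) Astar)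
    (hp : common_perp p (hline B D) (hline C1 C2))
    (hC : hline B D `&` p = [set Cstar])
    (hM : is_midpoint B D M) :
  is_midpoint Astar Cstar M.
Proof.
have [[inj _ _] [rB rC1 rC2 rD]] := hpent.
have BD : B <> D.
  (* Counting from 0, [B] and [D] are the vertices 1 and 4. *)
  by move=> e; have := inj (@Ordinal 5 1 isT) (@Ordinal 5 4 isT) e.
have [F BDF [w [w0 wC1 wC2 wF]]] := common_perp_normal hp.
have FC : F = Cstar by move: BDF; rewrite hC.
have lC : hline B D Cstar by rewrite -FC; case: BDF.
rewrite {F BDF}FC in wF.
have [wB eB] := right_angles_mink rB rC1 wC1 wC2 w0.
(* The same relation at [D], reading the pentagon in the opposite direction. *)
have [wD eD] :=
  right_angles_mink (right_angleC rD) (right_angleC rC2) wC2 wC1 w0.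
have [lA _] := hA.
have pB := orth_proj_mink hA (hlinel B D).
have pD := orth_proj_mink hA (hliner B D).
have wlB := wF _ (hlinel B D); have wlD := wF _ (hliner B D).
have AA : mink A Astar != 0 by rewrite lt_eqF ?mink_lt0.
have wC : mink w Cstar != 0.
  by apply: contraNneq wB => wC; rewrite wlB wC oppr0 mul0r.
have [x [y [xy eX eY]]] : exists x y : R, [/\ 0 < x + y,
    hvec Astar = x *: hvec B + y *: hvec D &
    hvec Cstar = y *: hvec B + x *: hvec D].
  (* Scaling by [mink A Astar * mink w Cstar] replaces [Astar] by [A] and [Cstar] by [w] in the
     products with [B] and [D]. *)
  apply: (hline_swap BD lA lC); apply: (mulfI (mulf_neq0 AA wC)).
  transitivity (mink A B * mink w B); first by rewrite pB wlB; ring.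
  by rewrite eB -eD pD wlD; ring.
exact: midpoint_swap BD xy eX eY hM.
Qed.
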